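(* The (complex) Kalton-Peck space $Z_2$ is the complexification of the real Kalton-Peck space $Z_2^{real}$; that is, $Z_2$ is isomorphic, as a complex (quasi-)Banach space, to the complexification $Z_2^{real}\oplus i\,Z_2^{real}$ of the real space $Z_2^{real}$.
   Context: Notation: $\ell_2(\mathbb R)$ is the real Hilbert space of square-summable real sequences and $\ell_2$ is its complex counterpart. Isomorphism means linear homeomorphism. The complexification of a real space $E$ is $E\oplus iE$ with the obvious complex multiplication and the product topology. Complex Kalton-Peck space. $Z_2$ is the derived space obtained from the pair $(\ell_\infty,\ell_1)$ of complex sequence spaces by complex interpolation at $1/2$. Concretely, let $\mathsf{KP}(y)=2\sum_m \log\frac{|y_m|}{\|y\|_2}\,y_m e_m$ for $0\neq y\in\ell_2$ (terms with $y_m=0$ being $0$) and $\mathsf{KP}(0)=0$. Then $Z_2$ is the complex vector space of pairs $(x,y)$ with $y\in\ell_2$ and $x$ a complex sequence such that $x-\mathsf{KP}(y)\in \ell_2$, endowed with the quasi-norm $\|x-\mathsf{KP}(y)\|_2+\|y\|_2$. Real Kalton-Peck space. $Z_2^{real}$ is the derived space obtained from the pair $(\ell_\infty,\ell_1)$ of real sequence spaces by real interpolation at $(1/2,1/2)$, the real method being presented in the following discrete form. Put $B_0=\ell_\infty$, $B_1=\ell_1$, $p_0=\infty$, $p_1=1$, $\theta=1/2$, with ambient space $\Sigma$ a sequence space containing both $B_0$ and $B_1$ (e.g. $\Sigma=\ell_\infty$). Let $\mathcal J$ be the space of all sequences $\{b_n\}_{n\in\mathbb Z}$ in $B_0\cap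 B_1$ with $\{e^{jn}b_n\}_{n\in\mathbb Z}\in \ell_{p_j}(\mathbb Z;B_j)$ for $j=0,1$, normed by $\max_{j=0,1}\|\{e^{jn}b_n\}\|_{\ell_{p_j}(B_j)}$. The interpolation space is $\{\sum_{n} e^{\theta n}b_n : \{b_n\}\in\mathcal J\}$ with the quotient norm; it is $\ell_2(\mathbb R)$ up to an equivalent norm. Fix $C>1$ and choose, homogeneously in $b$, for each $b\in \ell_2(\mathbb R)$ a sequence $\{b_n\}\in\mathcal J$ with $\sum_n e^{\theta n}b_n=b$ and $\|\{b_n\}\|_{\mathcal J}\le C\|b\|$. The associated differential is $\Omega(b)=\sum_{n\in\mathbb Z} n e^{\theta(n-1)}b_n\in\Sigma$. The derived space is the set of pairs $(x,y)\in \Sigma\times \ell_2(\mathbb R)$ with $x-\Omega(y)\in\ell_2(\mathbb R)$, endowed with the quasi-norm $\|x-\Omega(y)\|_2+\|y\|_2$. Another choice of $\{b_n\}$ changes $\Omega$ by a bounded map into $\ell_2(\mathbb R)$, so it gives the same space with an equivalent quasi-norm. *)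

(* Defs.v *)
From HB Require Import structures.
From mathcomp Require Import all_boot all_order all_algebra.
From mathcomp Require Import all_classical all_reals all_analysis.
From mathcomp Require Import complex.

Set Implicit Arguments.
Unset Strict Implicit.
Unset Printing Implicit Defensive.

Import Order.TTheory GRing.Theory Num.Theory.
Import numFieldNormedType.Exports.

Local Open Scope classical_set_scope.
Local Open Scope ring_scope.
Local Open Scope complex_scope.

(* [qdom] is the underlying vector space, given as a subset of an ambient
   vector space; the values of [qnorm] outside [qdom] are irrelevant.  The
   topology is the one whose neighbourhoods of a point [u] of [qdom] are
   generated by the balls [{v in qdom | qnorm (v - u) < e}]. *)
Record qspace (R : realType) (K : pzRingType) (V : lmodType K) := QSpace {
  qdom : set V ;
  qnorm : V -> R }.

Section Isomorphism.
Context {R : realType} {K : pzRingType} {V W : lmodType K}.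
Implicit Types (E : qspace R V) (F : qspace R W).

Definition subspace (D : set V) : Prop :=
  D 0 /\ forall (a : K) (u v : V), D u -> D v -> D (a *: u + v).

Definition linear_on (D : set V) (T : V -> W) : Prop :=
  forall (a : K) (u v : V), D u -> D v -> T (a *: u + v) = a *: T u + T v.

Definition qcontinuous E F (T : V -> W) : Prop :=
  forall u, qdom E u -> forall e : R, 0 < e ->
    exists2 d : R, 0 < d &
      forall v, qdom E v -> qnorm E (v - u) < d -> qnorm F (T v - T u) < e.

End Isomorphism.

Definition isomorphic (R : realType) (K : pzRingType) (V W : lmodType K)
    (E : qspace R V) (F : qspace R W) : Prop :=
  [/\ subspace (qdom E), subspace (qdom F) &
   exists (T : V -> W) (S : W -> V),
   [/\ linear_on (qdom E) T,
       (forall u, qdom E u -> qdom F (T u) /\ S (T u) = u),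
       (forall w, qdom F w -> qdom E (S w) /\ T (S w) = w),
       qcontinuous E F T &
       qcontinuous F E S]].

(* [(u, v) : complexified V] stands for [u + i v]. *)
Definition complexified (R : realType) (V : lmodType R) : Type := (V * V)%type.

Section ComplexifiedLmodule.
Variables (R : realType) (V : lmodType R).
Local Notation VC := (complexified V).

HB.instance Definition _ := GRing.Zmodule.copy VC (V * V)%type.

Definition cscale (z : R[i]) (w : VC) : VC :=
  (complex.Re z *: w.1 - complex.Im z *: w.2,
   complex.Re z *: w.2 + complex.Im z *: w.1).

Fact cscaleA (a b : R[i]) (w : VC) : cscale a (cscale b w) = cscale (a * b) w.
Proof.
case: a b w => [a1 a2] [b1 b2] [u v]; rewrite /cscale /=.
rewrite !(scalerBr, scalerDr, scalerBl, scalerDl, scalerA).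
congr pair.
  by rewrite !opprD -!addrA; congr (_ + _); rewrite [in RHS]addrCA !addrA addrAC.
by rewrite [(a2 * b1) *: u - _]addrC addrACA.
Qed.

Fact cscale1 : left_id 1 cscale.
Proof.
by case=> u v; rewrite /cscale /= !scale1r !scale0r subr0 addr0.
Qed.

Fact cscaleDr : right_distributive cscale +%R.
Proof.
move=> a [u1 v1] [u2 v2]; rewrite /cscale; congr pair => /=.
  by rewrite !scalerDr opprD addrACA.
by rewrite !scalerDr addrACA.
Qed.

Fact cscaleDl (w : VC) : {morph cscale^~ w : a b / a + b}.
Proof.
case: w => u v [a1 a2] [b1 b2]; rewrite /cscale; congr pair => /=.
  by rewrite !scalerDl opprD addrACA.
by rewrite !scalerDl addrACA.
Qed.

HB.instance Definition _ := GRing.Zmodule_isLmodule.Build R[i] VC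
  cscaleA cscale1 cscaleDr cscaleDl.

End ComplexifiedLmodule.

(* The balls of the maximum of the two quasi-norms are products of balls, so
   they induce the product topology. *)
Definition complexification (R : realType) (V : lmodType R) (E : qspace R V) :
    qspace R (complexified V) :=
  QSpace [set w : complexified V | qdom E w.1 /\ qdom E w.2]
         (fun w : complexified V => Num.max (qnorm E w.1) (qnorm E w.2)).

Section SequenceNorms.
Context {R : realType}.
Local Open Scope ereal_scope.

(* [u] is the sequence of the moduli of the entries. *)
Definition l2norm (u : nat -> R) : \bar R :=
  (\esum_(m in [set: nat]) (u m ^+ 2)%:E) `^ 2^-1.

Definition l1norm (u : nat -> R) : \bar R := \esum_(m in [set: nat]) (u m)%:E.

Definition linfnorm (u : nat -> R) : \bar R :=
  ereal_sup (range (fun m => (u m)%:E)).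

End SequenceNorms.

Notation rseq R := (nat -> R^o).
Notation cseq R := (nat -> R[i]).

Section RealSequences.
Context {R : realType}.
Implicit Type x : rseq R.

Definition rnorm2 x : \bar R := l2norm (fun m => `|x m|).
Definition rnorm1 x : \bar R := l1norm (fun m => `|x m|).
Definition rnormoo x : \bar R := linfnorm (fun m => `|x m|).
Definition rl2 : set (rseq R) := [set x | (rnorm2 x < +oo)%E].

End RealSequences.

Section ComplexSequences.
Context {R : realType}.
Implicit Type x : cseq R.

Definition cnorm2 x : \bar R := l2norm (fun m => Normc.normc (x m)).
Definition cl2 : set (cseq R) := [set x | (cnorm2 x < +oo)%E].

End ComplexSequences.

Section ComplexKaltonPeck.
Context {R : realType}.

(* No case distinction is needed: the terms with [y m = 0], and all the terms
   when [y = 0], vanish. *)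
Definition KP (y : cseq R) : cseq R :=
  fun m => (2 * ln (Normc.normc (y m) / fine (cnorm2 y)))%:C * y m.

Definition Z2 : qspace R (cseq R * cseq R)%type :=
  QSpace [set p : cseq R * cseq R | cl2 p.2 /\ cl2 (p.1 - KP p.2)]
         (fun p : cseq R * cseq R =>
            fine (cnorm2 (p.1 - KP p.2)) + fine (cnorm2 p.2)).

End ComplexKaltonPeck.

Section RealKaltonPeck.
Context {R : realType}.

(* Doubly infinite sequences [{b_n}] of real sequences. *)
Local Notation zseq := (int -> rseq R).

(* Recall that [Negz n] is [- n.+1]. *)
Definition zsum (f : int -> R) : R :=
  limn (series (fun n => f (Posz n))) + limn (series (fun n => f (Negz n))).

Definition theta : R := 2^-1.

(* The norm of [{e^{jn} b_n}] in [l_{p_j}(Z; B_j)], for [j = 0]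
   ([p_0 = +oo], [B_0 = l_oo], weight [1]) and [j = 1] ([p_1 = 1], [B_1 = l_1]). *)
Definition J0norm (b : zseq) : \bar R :=
  ereal_sup (range (fun n : int => rnormoo (b n))).
Definition J1norm (b : zseq) : \bar R :=
  (\esum_(n in [set: int]) rnorm1 (expR n%:~R *: b n))%E.

Definition Jnorm (b : zseq) : \bar R := maxe (J0norm b) (J1norm b).

Definition Jspace : set zseq :=
  [set b | (forall n, (rnormoo (b n) < +oo)%E /\ (rnorm1 (b n) < +oo)%E) /\
           (Jnorm b < +oo)%E].

(* The sum of [e^{theta n} b_n] and, below, that of [n e^{theta(n-1)} b_n] are
   taken entrywise: for [b] in [Jspace] both series converge absolutely in
   [l_oo]. *)
Definition Jsum (b : zseq) : rseq R :=
  fun m => zsum (fun n => expR (theta * n%:~R) * b n m).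

Definition Jdiff (b : zseq) : rseq R :=
  fun m => zsum (fun n => n%:~R * expR (theta * (n%:~R - 1)) * b n m).

(* The quotient norm; it is [+oo] outside the interpolation space. *)
Definition interp_norm (x : rseq R) : \bar R :=
  ereal_inf [set Jnorm b | b in [set b | Jspace b /\ Jsum b = x]].

(* [sel b] is the sequence [{b_n}] chosen for [b]. *)
Definition selection (C : R) (sel : rseq R -> zseq) : Prop :=
  [/\ (forall b, rl2 b -> Jspace (sel b) /\ Jsum (sel b) = b),
      (forall b, rl2 b -> (Jnorm (sel b) <= C%:E * interp_norm b)%E) &
      (forall (a : R) b, rl2 b -> sel (a *: b) = (fun n => a *: sel b n))].

Definition Omega (sel : rseq R -> zseq) (b : rseq R) : rseq R := Jdiff (sel b).

(* The ambient space is that of all real sequences; as [Omega sel y] is bounded,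
   taking [l_oo] instead would give the same pairs. *)
Definition Z2real (sel : rseq R -> zseq) : qspace R (rseq R * rseq R)%type :=
  QSpace [set p : rseq R * rseq R | rl2 p.2 /\ rl2 (p.1 - Omega sel p.2)]
         (fun p : rseq R * rseq R =>
            fine (rnorm2 (p.1 - Omega sel p.2)) + fine (rnorm2 p.2)).

End RealKaltonPeck.

(* Main.v *)
(* Let $k = e^{-1/2}$.  For a selection $y = \sum_n e^{n/2} b_n$ with
   $|b_n(m)| \le M$ and $\sum_n e^n \|b_n\|_1 \le M$, put
   $a(m) = \sum_n e^n |b_n(m)|$ and let $w(m)$ be of the order of
   $(\|y\| a(m) + |y(m)|^2)^{1/2}$; this $w$ is in $\ell_2$ with norm $O(\|y\|)$.
   Splitting $\sum_n (n - \kappa) e^{n/2} b_n(m)$ at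
   $\kappa = 2 \log(w(m)/\|y\|)$ bounds it by $O(w(m))$, and
   $t |\log t| \le 1$ on $(0,1]$ bounds
   $|y(m)| |\kappa - 2\log(|y(m)|/\|y\|)|$ by $O(w(m) + |y(m)|)$.  Hence
   $\Omega(y) - k\,\mathsf{KP}(y)$ is in $\ell_2$ with norm $O(\|y\|)$, so
   $(x, y) \mapsto (k^{-1} x, y)$ identifies $Z_2^{real}$ with the real pairs
   of $Z_2$.  As $\mathsf{KP}$ is quasi-additive and commutes with complex
   conjugation, a pair is in $Z_2$ exactly when its real and imaginary parts
   are, with control of the quasi-norms. *)

Require Import Defs.
From HB Require Import structures.
From mathcomp Require Import all_boot all_order all_algebra.
From mathcomp Require Import all_classical all_reals all_analysis.
From mathcomp Require Import complex.
From mathcomp Require Import ring lra.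

Set Implicit Arguments.
Unset Strict Implicit.
Unset Printing Implicit Defensive.

Import Order.TTheory GRing.Theory Num.Theory.
Import numFieldNormedType.Exports.
Local Open Scope classical_set_scope.
Local Open Scope ring_scope.

(** * Square-sum bounds on partial sums *)

Section SquareSums.
Context {R : realType}.
Implicit Types (u v w : nat -> R) (a b c : R).

(** Only finite real sums occur, so estimates avoid extended reals; [0 <= c] makes the squared bound
    equivalent to a bound on [l2norm]. *)
Definition sq_le u c := 0 <= c /\ forall N, \sum_(0 <= m < N) u m ^+ 2 <= c ^+ 2.

Lemma esum_nat_leP u s : (forall m, 0 <= u m) ->
  (\esum_(m in [set: nat]) (u m)%:E <= s%:E)%E <->
  forall N, \sum_(0 <= m < N) u m <= s.
Proof.
move=> u0; rewrite -nneseries_esumT; last by move=> m; rewrite lee_fin.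
split=> [h N|h].
  rewrite -lee_fin -sumEFin (le_trans _ h)//.
  by apply: nneseries_lim_ge => n _ _; rewrite lee_fin.
apply: lime_le; first by apply: is_cvg_nneseries => n _ _; rewrite lee_fin.
by apply: nearW => N; rewrite sumEFin lee_fin.
Qed.

Lemma l2norm_leP u c : (l2norm u <= c%:E)%E <-> sq_le u c.
Proof.
have e0 : (0 <= \esum_(m in [set: nat]) (u m ^+ 2)%:E)%E.
  by apply: esum_ge0 => m _; rewrite lee_fin sqr_ge0.
rewrite /l2norm poweR12_sqrt//.
have E (s : R) : 0 <= s -> (s%:E = sqrte (s ^+ 2)%:E)%E.
  by move=> s0; rewrite /= sqrtr_sqr ger0_norm.
have Q := @esum_nat_leP _ (c ^+ 2) (fun m => sqr_ge0 (u m)).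
split=> [h|[c0 h]].
  have c0 : 0 <= c by rewrite -lee_fin (le_trans _ h)// sqrte_ge0.
  by split=> //; apply/Q; rewrite -lee_sqrt ?lee_fin ?sqr_ge0// -E.
by rewrite E// lee_sqrt ?lee_fin ?sqr_ge0//; apply/Q.
Qed.

Lemma le_sq_le u v c : (forall m, `|u m| <= `|v m|) -> sq_le v c -> sq_le u c.
Proof.
move=> uv [c0 h]; split=> // N; apply: le_trans (h N).
apply: ler_sum => m _; rewrite -real_normK ?num_real//.
by rewrite -[leRHS]real_normK ?num_real// lerXn2r ?nnegrE.
Qed.

Lemma sq_leZ u c a : sq_le u c -> sq_le (fun m => a * u m) (`|a| * c).
Proof.
move=> [c0 h]; split=> [|N]; first by rewrite mulr_ge0.
rewrite exprMn real_normK ?num_real//; under eq_bigr do rewrite exprMn.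
by rewrite -mulr_sumr ler_wpM2l ?sqr_ge0.
Qed.

(** The pointwise inequality $(u+v)^2 \le 2u^2 + 2v^2$ replaces Minkowski; the lost factor 2 is
    harmless for quasi-norms. *)
Lemma sq_leD u v a b : sq_le u a -> sq_le v b ->
  sq_le (fun m => u m + v m) (2 * (a + b)).
Proof.
move=> [a0 ha] [b0 hb]; split=> [|N]; first by rewrite mulr_ge0 ?addr_ge0.
apply: (@le_trans _ _ (\sum_(0 <= m < N) (2 * u m ^+ 2 + 2 * v m ^+ 2))).
  by apply: ler_sum => m _; have := sqr_ge0 (u m - v m); nra.
rewrite big_split/= -!mulr_sumr; have := ha N; have := hb N; nra.
Qed.

Lemma sq_le_widen u a b : sq_le u a -> a <= b -> sq_le u b.
Proof.
move=> [a0 h] ab; split=> [|N]; first exact: le_trans ab.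
by rewrite (le_trans (h N))// lerXn2r ?nnegrE// (le_trans a0).
Qed.

End SquareSums.

(** * Norm bounds for complex sequences *)

Section ComplexL2.
Context {R : realType}.
Implicit Types (x y : cseq R) (c : R).

Definition cbd x c := sq_le (fun m => Normc.normc (x m)) c.

Lemma normc_ge0 (z : R[i]) : 0 <= Normc.normc z.
Proof. by case: z => a b; rewrite /= sqrtr_ge0. Qed.

Lemma normcR (a : R) : Normc.normc a%:C%C = `|a|.
Proof. by rewrite /= expr0n/= addr0 sqrtr_sqr. Qed.

Lemma cnorm2_fineP x c : cbd x c -> cl2 x /\ fine (cnorm2 x) <= c.
Proof.
move=> /l2norm_leP h; rewrite -/(cnorm2 x) in h.
have l : cl2 x by rewrite /cl2/= (le_lt_trans h)// ltry.
split=> //; rewrite -lee_fin fineK// ge0_fin_numE//; exact: poweR_ge0.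
Qed.

Lemma cl2_bd x : cl2 x -> cbd x (fine (cnorm2 x)).
Proof.
move=> l; apply/l2norm_leP; rewrite -/(cnorm2 x) fineK// ge0_fin_numE//.
exact: poweR_ge0.
Qed.

Lemma cbdD x y a b : cbd x a -> cbd y b -> cbd (x + y) (2 * (a + b)).
Proof.
move=> hx hy; apply: le_sq_le (sq_leD hx hy) => m /=.
by rewrite !ger0_norm ?addr_ge0 ?normc_ge0//; exact: le_normcD.
Qed.

Lemma cbdZ x c (z : R[i]) : cbd x c -> cbd (z *: x) (Normc.normc z * c).
Proof.
move=> h; have := sq_leZ (Normc.normc z) h; rewrite ger0_norm ?normc_ge0//.
by apply: le_sq_le => m; rewrite -Normc.normcM.
Qed.

Lemma cbdN x c : cbd x c -> cbd (- x) c.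
Proof. by apply: le_sq_le => m; rewrite (normcN (x m)). Qed.

End ComplexL2.

(** * Quasi-linearity of the Kalton-Peck map and the space [Z2] *)

Section KaltonPeckMap.
Context {R : realType}.
Implicit Types (x y u v : cseq R) (p q : cseq R * cseq R).

Local Notation n2 y := (fine (cnorm2 y)).

Lemma n2_ge0 y : 0 <= n2 y.
Proof. exact/fine_ge0/poweR_ge0. Qed.

Lemma n2_eq0 y m : cl2 y -> n2 y = 0 -> y m = 0.
Proof.
move=> /cl2_bd[_ h] y0; apply: Normc.eq0_normc; apply/eqP.
rewrite -sqrf_eq0 eq_le sqr_ge0 andbT.
have := h m.+1; rewrite y0 expr0n/=; apply: le_trans.
by rewrite big_nat_recr//= lerDr sumr_ge0// => i _; exact: sqr_ge0.
Qed.

(* Replacing the modulus [r] and the norm [rho] by upper bounds [w] and [L]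
   changes [r * ln (r / rho)] by a controlled amount, because
   [r * ln (w / r) <= w]. *)
Lemma ln_ratio_compare (r w rho L : R) :
  0 <= r <= w -> 0 <= rho <= L -> (rho = 0 -> r = 0) ->
  `|2 * ln (r / rho) - 2 * ln (w / L)| * r <= 2 * w + 2 * (L / rho) * r.
Proof.
move=> /andP[r0 rw] /andP[rho0 rhoL] h.
have [->|rN0] := eqVneq r 0; first by rewrite !mulr0 addr0 mulr_ge0//; exact: le_trans rw.
have rp : 0 < r by rewrite lt_neqAle eq_sym rN0.
have rhop : 0 < rho.
  by rewrite lt_neqAle rho0 andbT eq_sym; apply/eqP => /h/eqP; rewrite (negPf rN0).
have wp : 0 < w by exact: lt_le_trans rw.
have Lp : 0 < L by exact: lt_le_trans rhoL.
have -> : 2 * ln (r / rho) - 2 * ln (w / L) = 2 * (ln (L / rho) - ln (w / r)).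
  by rewrite !ln_div ?posrE//; ring.
have a0 : 0 <= ln (L / rho) by rewrite ln_ge0// ler_pdivlMr// mul1r.
have b0 : 0 <= ln (w / r) by rewrite ln_ge0// ler_pdivlMr// mul1r.
have a1 : ln (L / rho) <= L / rho by rewrite ltW// ln_sublinear// divr_gt0.
have b1 : ln (w / r) * r <= w.
  by rewrite -ler_pdivlMr// ltW// ln_sublinear// divr_gt0.
have : `|ln (L / rho) - ln (w / r)| <= ln (L / rho) + ln (w / r).
  by rewrite ler_norml; apply/andP; split; lra.
rewrite normrM gtr0_norm// => c1; nra.
Qed.

(** Up to an $\ell_2$ error, [KP y] may be replaced by the product of [y] with a sequence depending
    only on [w] and [L]. By [ln_ratio_compare] the pointwise error is at most $2w + 2(L/\|y\|)|y|$,
    whose summands have norms at most $2W$ and $2L$. *)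
Lemma KP_compare y (w : nat -> R) (W L : R) : cl2 y ->
  (forall m, Normc.normc (y m) <= w m) -> sq_le w W -> n2 y <= L ->
  cbd (fun m => KP y m - (2 * ln (w m / L))%:C%C * y m) (4 * (W + L)).
Proof.
move=> yl yw wW yL; have n0 := n2_ge0 y.
have hL : sq_le (fun m => 2 * (L / n2 y) * Normc.normc (y m)) (2 * L).
  apply: sq_le_widen (sq_leZ _ (cl2_bd yl)) _.
  have L0 : 0 <= L := le_trans n0 yL.
  rewrite ger0_norm ?mulr_ge0 ?divr_ge0 ?invr_ge0//.
  (* For [n2 y = 0] the quotient [L / n2 y] is 0 by convention. *)
  have [->|nN0] := eqVneq (n2 y) 0; first by rewrite mulr0 mulr_ge0//.
  by rewrite -!mulrA mulVf// mulr1.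
have h2 := sq_leD (sq_leZ 2 wW) hL.
have W0 := wW.1.
apply: (@sq_le_widen _ _ (2 * (`|2| * W + 2 * L))); last by rewrite gtr0_norm//; lra.
apply: le_sq_le h2 => m.
have E : 0 <= Normc.normc (y m) <= w m by rewrite normc_ge0 yw.
have F : 0 <= n2 y <= L by rewrite n0.
rewrite ger0_norm ?normc_ge0// (le_trans _ (ler_norm _))//.
apply: le_trans (ln_ratio_compare E F _); last first.
  by move=> /(n2_eq0 m yl) ->; rewrite Normc.normc0.
by rewrite /KP -mulrBl -rmorphB Normc.normcM normcR.
Qed.

(** Comparing all three values of [KP] through the same $w = |u| + |v|$ and $L = 2s$ makes the
    multiplier common, so the main terms cancel by linearity. *)
Lemma KP_quasiadditive u v : cl2 u -> cl2 v ->
  cbd (KP (u + v) - KP u - KP v) (160 * (n2 u + n2 v)).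
Proof.
move=> ul vl; set s := n2 u + n2 v.
have u0 := n2_ge0 u; have v0 := n2_ge0 v.
have [uvl uvs] := cnorm2_fineP (cbdD (cl2_bd ul) (cl2_bd vl)).
rewrite -/s in uvs.
pose w m := Normc.normc (u m) + Normc.normc (v m).
have wW : sq_le w (2 * s) := sq_leD (cl2_bd ul) (cl2_bd vl).
have h1 := KP_compare uvl (fun m => le_normcD (u m) (v m)) wW uvs.
have uw m : Normc.normc (u m) <= w m by rewrite lerDl normc_ge0.
have us : n2 u <= 2 * s by rewrite /s; lra.
have h2 := KP_compare ul uw wW us.
have vw m : Normc.normc (v m) <= w m by rewrite lerDr normc_ge0.
have vs : n2 v <= 2 * s by rewrite /s; lra.
have h3 := KP_compare vl vw wW vs.
(* Each comparison costs $4(2s + 2s) = 16s$; adding with the factor 2 gives $2(2(16 + 16) + 16) =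
   160$. *)
have := cbdD (cbdD h1 (cbdN h2)) (cbdN h3).
set b := (X in cbd _ X); have -> : b = 160 * s by rewrite /b; ring.
by congr cbd; apply/funext => m; rewrite !fctE/=; ring.
Qed.

Lemma n2Z (z : R[i]) y : cl2 y -> n2 (z *: y) = Normc.normc z * n2 y.
Proof.
move=> yl; have [zyl le1] := cnorm2_fineP (cbdZ z (cl2_bd yl)).
apply/eqP; rewrite eq_le le1/=.
have [->|z0] := eqVneq z 0; first by rewrite Normc.normc0 mul0r n2_ge0.
(* The reverse inequality is the upper bound applied to $z^{-1}$ and $zy$. *)
have := (cnorm2_fineP (cbdZ z^-1 (cl2_bd zyl))).2.
rewrite scalerA mulVf// scale1r Normc.normcV mulrC ler_pdivlMr// 1?mulrC//.
rewrite lt_neqAle normc_ge0 andbT eq_sym.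
by apply: contra z0 => /eqP/Normc.eq0_normc ->.
Qed.

Lemma KPZ (z : R[i]) y : cl2 y -> KP (z *: y) = z *: KP y.
Proof.
move=> yl; apply/funext => m; rewrite -[RHS]/(z * KP y m) /KP n2Z//.
have -> : (z *: y) m = z * y m by [].
rewrite Normc.normcM.
have [->|z0] := eqVneq z 0; first by rewrite !mul0r mulr0.
have zN0 : Normc.normc z != 0 by apply: contra z0 => /eqP/Normc.eq0_normc ->.
by rewrite mulrCA -mulf_div divff ?mul1r.
Qed.

Definition cconj x : cseq R := fun m => (x m)^*%C.

Lemma normc_conj (z : R[i]) : Normc.normc z^*%C = Normc.normc z.
Proof. by case: z => a b; rewrite /= sqrrN. Qed.

Lemma cbdJ x (c : R) : cbd x c -> cbd (cconj x) c.
Proof. by apply: le_sq_le => m; rewrite normc_conj. Qed.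

Lemma KPJ y : KP (cconj y) = cconj (KP y).
Proof.
have E : cnorm2 (cconj y) = cnorm2 y.
  by rewrite /cnorm2; congr l2norm; apply/funext => m; rewrite normc_conj.
apply/funext => m; rewrite /cconj /KP -/(cconj y) E normc_conj [RHS]rmorphM/=.
by congr (_ * _); rewrite -[_%:C%C]/((_ +i* _)%C) /= oppr0.
Qed.

(** By [Z2bdP] such a bound also certifies membership in [Z2], so domain and quasi-norm are handled
    together. *)
Definition Z2bd p (c : R) := cbd p.2 c /\ cbd (p.1 - KP p.2) c.

Lemma Z2_bd p : qdom Z2 p -> Z2bd p (qnorm Z2 p).
Proof.
move=> [/cl2_bd h2 /cl2_bd h1]; split.
  by apply: sq_le_widen h2 _; rewrite lerDr n2_ge0.
by apply: sq_le_widen h1 _; rewrite lerDl n2_ge0.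
Qed.

Lemma Z2bdP p (c : R) : Z2bd p c -> qdom Z2 p /\ qnorm Z2 p <= 2 * c.
Proof.
move=> [/cnorm2_fineP[l2 h2] /cnorm2_fineP[l1 h1]]; split=> //.
by rewrite mulrC mulrDr mulr1 lerD.
Qed.

(** In [Z2bdD] the inner 2 comes from adding the differences [p.1 - KP p.2] and [q.1 - KP q.2], the
    160 from [KP_quasiadditive], and the outer 2 from combining the two. *)
Definition Z2_quasi : R := 2 * (2 + 160).

Lemma Z2_quasi_gt0 : 0 < Z2_quasi.
Proof. by rewrite mulr_gt0// addr_gt0// ltr0n. Qed.

Lemma Z2bdD p q (a b : R) : Z2bd p a -> Z2bd q b -> Z2bd (p + q) (Z2_quasi * (a + b)).
Proof.
move=> [p2 p1] [q2 q1]; have a0 := p2.1; have b0 := q2.1; rewrite /Z2_quasi; split.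
  by apply: sq_le_widen (cbdD p2 q2) _; lra.
have [pl ple] := cnorm2_fineP p2; have [ql qle] := cnorm2_fineP q2.
have := cbdD (cbdD p1 q1) (cbdN (KP_quasiadditive pl ql)).
set F := (X in cbd X) => h.
have -> : (p + q).1 - KP (p + q).2 = F.
  by rewrite /F [(p + q).1]/(p.1 + q.1) [(p + q).2]/(p.2 + q.2) [in RHS]addrACA -opprD
    -[_ - KP p.2 - KP q.2]addrA -opprD opprB subrKA.
by apply: sq_le_widen h _; lra.
Qed.

Lemma Z2bdZ p (c : R) (z : R[i]) : Z2bd p c -> Z2bd (z *: p) (Normc.normc z * c).
Proof.
move=> [p2 p1]; split; first exact: cbdZ.
rewrite [(z *: p).1]/(z *: p.1) [(z *: p).2]/(z *: p.2).
by rewrite (KPZ z (cnorm2_fineP p2).1) -scalerBr; exact: cbdZ.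
Qed.

Lemma Z2bdJ p (c : R) : Z2bd p c -> Z2bd (cconj p.1, cconj p.2) c.
Proof.
move=> [p2 p1]; split; first exact: cbdJ.
have := cbdJ p1; congr cbd; apply/funext => m.
by rewrite /= KPJ /cconj !fctE/= rmorphB.
Qed.

End KaltonPeckMap.

(** * Series indexed by the integers *)

Section BilateralSeries.
Context {R : realType}.
Implicit Types (f g : int -> R) (s t a : R).

(** The window is $-N \le n < N$. For nonnegative [g] this bounds the whole sum; convergence of
    [zsum f] is obtained from it with [g] the absolute value of [f]. *)
Definition zbd g s := forall N,
  \sum_(0 <= i < N) g (Posz i) + \sum_(0 <= i < N) g (Negz i) <= s.

Lemma le_zbd f g s : (forall n, f n <= g n) -> zbd g s -> zbd f s.
Proof. by move=> fg h N; apply: le_trans (h N); rewrite lerD// ler_sum. Qed.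

Lemma zbdD f g s t : zbd f s -> zbd g t -> zbd (fun n => f n + g n) (s + t).
Proof. by move=> hf hg N; rewrite !big_split/= addrACA lerD. Qed.

Lemma zbdZ f s a : 0 <= a -> zbd f s -> zbd (fun n => a * f n) (a * s).
Proof. by move=> a0 h N; rewrite -!mulr_sumr -mulrDr ler_wpM2l. Qed.

Lemma esum_zbd g s : (forall n, 0 <= g n) ->
  (\esum_(n in [set: int]) (g n)%:E <= s%:E)%E -> zbd g s.
Proof.
move=> g0 h N; rewrite -lee_fin; apply: le_trans h; apply: esum_ge.
pose r := [seq Posz i | i <- index_iota 0 N] ++ [seq Negz i | i <- index_iota 0 N].
have ur : uniq r.
  rewrite cat_uniq !map_inj_uniq ?iota_uniq//=; [|by move=> ? ? []..].
  by rewrite andbT; apply/hasPn => _ /mapP[i _ ->]; apply/mapP => -[].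
exists [set` r]; first by split=> //; exact: finite_seq.
by rewrite -fsbig_seq// big_cat !big_map/= !sumEFin.
Qed.

Lemma zbd_cvg f s : zbd (fun n => `|f n|) s ->
  [/\ cvgn (series (f \o Posz)), cvgn (series (f \o Negz)) & `|zsum f| <= s].
Proof.
move=> h.
have p0 (g : nat -> int) N : 0 <= \sum_(0 <= i < N) `|f (g i)| by rewrite sumr_ge0.
have nc (g : nat -> int) : (forall N, \sum_(0 <= i < N) `|f (g i)| <= s) ->
    cvgn [normed series (f \o g)].
  move=> hg; apply: nondecreasing_is_cvgn.
    by apply: nondecreasing_series => ? _ _; exact: normr_ge0.
  by exists s => _ [N _ <-]; exact: hg.
have c1 : cvgn [normed series (f \o Posz)].
  by apply: nc => N; apply: le_trans (h N); rewrite lerDl.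
have c2 : cvgn [normed series (f \o Negz)].
  by apply: nc => N; apply: le_trans (h N); rewrite lerDr.
split; [exact: normed_cvg c1|exact: normed_cvg c2|].
apply: le_trans (ler_normD _ _) _.
apply: le_trans (lerD (lim_series_norm c1) (lim_series_norm c2)) _.
(* [zbd] bounds the two halves jointly, so their limits are merged into one before comparison with
   [s]. *)
rewrite -limD//; apply: limr_le; first exact: is_cvgD.
by apply: nearW => N; exact: h.
Qed.

Lemma zsumD f g s t :
  zbd (fun n => `|f n|) s -> zbd (fun n => `|g n|) t ->
  zsum (fun n => f n + g n) = zsum f + zsum g.
Proof.
move=> /zbd_cvg[f1 f2 _] /zbd_cvg[g1 g2 _]; rewrite /zsum.
by rewrite (lim_seriesD f1 g1) (lim_seriesD f2 g2) addrACA.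
Qed.

Lemma zsumZ f s a : zbd (fun n => `|f n|) s ->
  zsum (fun n => a * f n) = a * zsum f.
Proof.
move=> /zbd_cvg[f1 f2 _]; rewrite /zsum mulrDr.
by rewrite (lim_seriesZ a f1) (lim_seriesZ a f2).
Qed.

Lemma zsum_single f (k : int) : (forall n, n != k -> f n = 0) -> zsum f = f k.
Proof.
move=> h.
have E (g : nat -> int) (j : nat) : (forall i, i != j -> f (g i) = 0) ->
    limn (series (f \o g)) = f (g j).
  move=> hg; apply: (@lim_near_cst R^o) => //; near=> N.
  rewrite /series/= (bigD1_seq j) ?iota_uniq//=; last first.
    by rewrite mem_index_iota/=; near: N; exists j.+1.
  by rewrite big1 ?addr0// => i /hg.
have Z (g : nat -> int) : (forall i, f (g i) = 0) -> limn (series (f \o g)) = 0.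
  by move=> hg; rewrite (E g 0%N) ?hg.
rewrite /zsum; case: k h => k h.
  rewrite (E Posz k) ?(Z Negz) ?addr0// => i; first exact: h.
  by move=> ik; apply: h; apply: contra ik => /eqP[->].
rewrite (E Negz k) ?(Z Posz) ?add0r// => i; first exact: h.
by move=> ik; apply: h; apply: contra ik => /eqP[->].
Unshelve. all: by end_near. Qed.

End BilateralSeries.

(** * Uniform summability of an exponential profile over integer translates *)

Section ExponentialDecay.
Context {R : realType}.
Implicit Types t x k : R.

Definition decay t : R := (1 + `|t|) * expR (- (`|t| / 2)).

(* [decay] is dominated by the increments of the bounded function [G], so its
   sums over the translates of the integers telescope. *)
Let G x : R := x / (1 + `|x|).

Let G_bound x : - 1 <= G x <= 1.
Proof.
have h : 0 < 1 + `|x| by rewrite ltr_wpDr.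
rewrite /G lter_pdivlMr// lter_pdivrMr//.
by have := ler_norm x; have := ler_norm (- x); rewrite normrN => *; lra.
Qed.

(** There is equality for $t \ge 0$. For $-1 \le t < 0$ the difference is a fraction whose sign is
    settled by $3 + t - t^2 > 0$; for $t < -1$ the right side is $1/(-t(1-t))$ and $-t < 2-t$. *)
Let G_step t : ((1 + `|t|) * (2 + `|t|))^-1 <= G (t + 1) - G t.
Proof.
rewrite /G; have [t0|t0] := ger0P t.
  rewrite ger0_norm; last by lra.
  rewrite le_eqVlt; apply/orP; left; apply/eqP.
  field. by apply/andP; split; apply/eqP; lra.
have [t1|t1] := ger0P (t + 1).
  rewrite -subr_ge0.
  have -> : (t + 1) / (1 + (t + 1)) - t / (1 - t) - ((1 - t) * (2 - t))^-1 =
    2 * (- t) * (3 + t - t ^+ 2) / ((2 + t) * (1 - t) * (2 - t)).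
    by field; apply/and3P; split; apply/eqP; lra.
  by rewrite divr_ge0// ?mulr_ge0//; nra.
have -> : (t + 1) / (1 - (t + 1)) - t / (1 - t) = (- t * (1 - t))^-1.
  field. by apply/and3P; split; apply/eqP; lra.
rewrite lef_pV2 ?posrE ?mulr_gt0//; [|lra..].
have -> : (1 - t) * (2 - t) = - t * (1 - t) + 2 * (1 - t) by ring.
lra.
Qed.

(** The exponential beats a cubic: $e^{a/2} = (e^{a/8})^4 \ge ((1+a)/8)^4$, while $(1+a)^2(2+a) \le
    2(1+a)^3 \le 2(1+a)^4$. *)
Let decay_le t : decay t <= (2 * 8 ^+ 4) * (G (t + 1) - G t).
Proof.
set a := `|t|; have a0 : 0 <= a by rewrite normr_ge0.
apply: le_trans (_ : 2 * 8 ^+ 4 * ((1 + a) * (2 + a))^-1 <= _); last first.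
  by rewrite ler_wpM2l// G_step.
rewrite ler_pdivlMr; last by nra.
rewrite /decay -/a expRN mulrAC ler_pdivrMr ?expR_gt0//.
have -> : a / 2 = (a / 8) * 4%:R by field.
rewrite expRM_natr.
have h : 1 + a <= 8 * expR (a / 8) by have := expR_ge1Dx (a / 8); lra.
have h4 : (1 + a) ^+ 4 <= (8 * expR (a / 8)) ^+ 4.
  by rewrite lerXn2r ?nnegrE//; lra.
rewrite exprMn in h4.
have h5 : (1 + a) * ((1 + a) * (2 + a)) <= 2 * (1 + a) ^+ 3 by nra.
have h6 : (1 + a) ^+ 3 <= (1 + a) ^+ 4 by rewrite ler_weXn2l//; lra.
by rewrite (le_trans h5)// -mulrA ler_wpM2l// (le_trans h6)//.
Qed.

(** Uniformity in [k] is essential, since the splitting level varies with the entry. The telescoped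
    increments of [G] total at most 2. *)
Lemma zbd_decay k : zbd (fun n => decay (n%:~R - k)) (4 * 8 ^+ 4).
Proof.
pose H (n : int) := G (n%:~R - k).
apply: (@le_zbd _ _ (fun n => (2 * 8 ^+ 4) * (H (n + 1) - H n))).
  move=> n; apply: le_trans (decay_le _) _.
  by rewrite /H rmorphD/= addrAC.
have -> : 4 * 8 ^+ 4 = (2 * 8 ^+ 4) * 2 :> R by rewrite mulrAC -natrM.
apply: zbdZ => [|N]; first by rewrite mulr_ge0 ?exprn_ge0.
rewrite (_ : \sum_(0 <= i < N) (H (Posz i + 1) - H (Posz i)) = H (Posz N) - H 0); last first.
  rewrite -(telescope_sumr (fun i => H (Posz i)))//; apply: eq_bigr => i _.
  by rewrite -PoszD addn1.
(* As [Negz i + 1] is $-i$, the terms are $H(-i) - H(-(i+1))$. *)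
rewrite (_ : \sum_(0 <= i < N) (H (Negz i + 1) - H (Negz i)) = H 0 - H (- Posz N)); last first.
  have := telescope_sumr (fun i => H (- Posz i)) (leq0n N).
  rewrite oppr0 => /(congr1 -%R); rewrite opprB => <-; rewrite -sumrN.
  by apply: eq_bigr => i _; rewrite opprB NegzE -addn1 PoszD opprD addrNK.
have := G_bound ((Posz N)%:~R - k); have := G_bound ((- Posz N)%:~R - k).
by rewrite -/(H N) -/(H (- Posz N)) => /andP[? ?] /andP[? ?]; lra.
Qed.

End ExponentialDecay.

(** * Entrywise estimates for sequences in the space [Jspace] *)

Section JSpaceEstimates.
Context {R : realType}.
Implicit Types (b : int -> rseq R) (f : int -> R) (M a s : R).

Definition decay_mass : R := 4 * 8 ^+ 4.

(* The bound by [M] is used for [n <= kappa] and the one by the weighted sum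
   for [n >= kappa], where [kappa = 2 ln s]. *)
Lemma weighted_term_le f M s n : 0 < s -> `|f n| <= M ->
  (1 + `|n%:~R - 2 * ln s|) * `|expR (theta * n%:~R) * f n| <=
  2 / s * (expR n%:~R * `|f n|) + M * s * decay (n%:~R - 2 * ln s).
Proof.
move=> s0 fM; rewrite normrM (gtr0_norm (expR_gt0 _)).
set x : R := n%:~R; set c := `|f n|; have c0 : 0 <= c by exact: normr_ge0.
have -> : s = expR (ln s) by rewrite lnK.
set k := ln s; rewrite expRK; set t := x - 2 * k.
have d0 : 0 <= decay t by rewrite mulr_ge0 ?expR_ge0// addr_ge0.
have M0 : 0 <= M := le_trans c0 fM.
have [t0|t0] := ger0P t.
  have h : 1 + t <= 2 * expR (t / 2) by have := expR_ge1Dx (t / 2); lra.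
  (* Here $t/2 + x/2 = x - k$, so $e^{t/2} e^{x/2} = e^x/s$. *)
  have E : 2 / expR k * (expR x * c) = 2 * expR (t / 2) * (expR (theta * x) * c).
    transitivity (2 * (expR x / expR k) * c); first by ring.
    rewrite -expRB (_ : x - k = t / 2 + theta * x) ?expRD; first by ring.
    by rewrite /t /theta; field.
  rewrite E -[leLHS]addr0 lerD// ?mulr_ge0 ?expR_ge0//.
  by rewrite ler_wpM2r ?mulr_ge0 ?expR_ge0.
(* Here $x/2 = k - |t|/2$, so $e^{x/2} = s\,e^{-|t|/2}$ and the bound [M] on the entry produces
   [decay]. *)
have E : expR k * expR (- (`|t| / 2)) = expR (theta * x).
  by rewrite -expRD (ltr0_norm t0); congr expR; rewrite /t /theta; field.
rewrite -[leLHS]add0r lerD ?mulr_ge0 ?divr_ge0 ?expR_ge0//.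
rewrite (_ : M * _ * _ = (1 + `|t|) * (expR k * expR (- (`|t| / 2)) * M)); last first.
  by rewrite /decay; ring.
by rewrite E (ltr0_norm t0) !ler_wpM2l ?expR_ge0//; lra.
Qed.

(** Pulling out $e^{-\theta}$ leaves $\sum_n (n - 2\ln s) e^{\theta n} f(n)$, to which
    [weighted_term_le] applies termwise; the weighted sum contributes [a] and the decaying part
    [decay_mass]. The factor $e^{-\theta} \le 1$ is dropped. *)
Lemma Jdiff_compare f M a s : 0 < s -> (forall n, `|f n| <= M) ->
  zbd (fun n => expR n%:~R * `|f n|) a ->
  `|zsum (fun n => n%:~R * expR (theta * (n%:~R - 1)) * f n) -
    expR (- theta) * (2 * ln s) * zsum (fun n => expR (theta * n%:~R) * f n)|
  <= 2 / s * a + M * s * decay_mass.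
Proof.
move=> s0 fM ha; set k := 2 * ln s; set B := leRHS.
have M0 : 0 <= M := le_trans (normr_ge0 _) (fM 0).
pose g n := expR (theta * n%:~R) * f n.
(* The weight $1 + |n - k|$ gives at once the absolute convergence of $\sum g$ and of $\sum (n-k)
   g$, hence of $\sum n g$. *)
have hB : zbd (fun n => (1 + `|n%:~R - k|) * `|g n|) B.
  apply: le_zbd (fun n => weighted_term_le s0 (fM n)) _.
  apply: zbdD; first by apply: zbdZ => //; rewrite divr_ge0// ltW.
  by apply: zbdZ; [rewrite mulr_ge0// ltW|exact: zbd_decay].
have hg : zbd (fun n => `|g n|) B.
  by apply: le_zbd hB => n; rewrite ler_peMl// lerDl.
have hd : zbd (fun n => `|(n%:~R - k) * g n|) B.
  by apply: le_zbd hB => n; rewrite normrM ler_wpM2r// lerDr.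
have hkg : zbd (fun n => `|k * g n|) (`|k| * B).
  by move: (zbdZ (normr_ge0 k) hg); apply: le_zbd => n; rewrite normrM.
have hng : zbd (fun n => `|n%:~R * g n|) (B + `|k| * B).
  apply: le_zbd (zbdD hd hkg) => n; apply: le_trans (ler_normD _ _).
  by rewrite -mulrDl subrK.
rewrite (_ : zsum _ = expR (- theta) * zsum (fun n => n%:~R * g n)); last first.
  rewrite -(zsumZ _ hng); congr zsum; apply/funext => n.
  by rewrite /g mulrBr mulr1 expRD; ring.
rewrite -mulrA -mulrBr -(zsumZ _ hg).
rewrite (_ : zsum (fun n => n%:~R * g n) - _ = zsum (fun n => (n%:~R - k) * g n)); last first.
  rewrite -(_ : zsum (fun n => (n%:~R - k) * g n + k * g n) = zsum (fun n => n%:~R * g n)).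
    by rewrite (zsumD hd hkg) addrK.
  by congr zsum; apply/funext => n; rewrite -mulrDl subrK.
have [_ _ h] := zbd_cvg hd.
rewrite normrM (gtr0_norm (expR_gt0 _)) (le_trans _ h)//.
by rewrite ler_piMl// expR_le1 oppr_le0 invr_ge0.
Qed.

Lemma esum_swap (T1 T2 : choiceType) (u : T1 -> T2 -> \bar R) :
  (forall i j, (0 <= u i j)%E) ->
  \esum_(i in [set: T1]) \esum_(j in [set: T2]) u i j =
  \esum_(j in [set: T2]) \esum_(i in [set: T1]) u i j.
Proof.
move=> u0; rewrite !esum_esum//.
rewrite (@reindex_esum _ _ _ [set: (T2 * T1)%type] _ (fun p => (p.2, p.1))).
  by congr esum; apply/seteqP; split.
split=> [p _|p q _ _ [? ?]|[i j] _] //; last by exists (j, i).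
by rewrite (surjective_pairing p) (surjective_pairing q); congr pair.
Qed.

(** By Tonelli, $\sum_n e^n \|b_n\|_1 = \sum_m a(m)$ with $a(m) = \sum_n e^n |b_n(m)|$, which turns
    the $\ell_1$ endpoint condition into a summable bound per entry. *)
Lemma Jnorm_bounds b M : (Jnorm b <= M%:E)%E ->
  (forall n m, `|b n m| <= M) /\
  exists a : nat -> R, [/\ forall m, 0 <= a m,
    forall m, zbd (fun n => expR n%:~R * `|b n m|) (a m) &
    forall N, \sum_(0 <= m < N) a m <= M].
Proof.
rewrite /Jnorm ge_max => /andP[h0 h1]; split.
  move=> n m; rewrite -lee_fin; apply: le_trans h0.
  apply: (@le_trans _ _ (rnormoo (b n))); apply: ereal_sup_ubound.
    by exists m.
  by exists n.
pose u n m := (expR n%:~R * `|b n m|)%:E.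
have u0 n m : (0 <= u n m)%E by rewrite lee_fin mulr_ge0 ?expR_ge0.
have E : J1norm b = \esum_(m in [set: nat]) \esum_(n in [set: int]) u n m.
  rewrite -esum_swap//; apply: eq_esum => n _; apply: eq_esum => m _.
  by rewrite /u -[(_ *: b n) m]/(expR n%:~R * b n m) normrM (gtr0_norm (expR_gt0 _)).
rewrite E in h1.
have A0 m : (0 <= \esum_(n in [set: int]) u n m)%E by apply: esum_ge0.
have AM m : (\esum_(n in [set: int]) u n m <= M%:E)%E.
  apply: le_trans h1; apply: esum_ge; exists [set m].
    by split=> //; exact: finite_set1.
  by rewrite fsbig_set1.
have Af m : \esum_(n in [set: int]) u n m \is a fin_num.
  by rewrite ge0_fin_numE// (le_lt_trans (AM m))// ltry.
exists (fun m => fine (\esum_(n in [set: int]) u n m)); split=> [m|m|].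
- exact: fine_ge0.
- by apply: esum_zbd => [n|]; [rewrite mulr_ge0 ?expR_ge0|rewrite fineK].
apply/esum_nat_leP => [m|]; first exact: fine_ge0.
by apply: le_trans h1; apply: le_esum => m _; rewrite fineK.
Qed.

End JSpaceEstimates.

(** * Comparison of the real differential with the Kalton-Peck map *)

Section RealKaltonPeckMap.
Context {R : realType}.
Implicit Types (y : rseq R) (C : R).

Local Notation n2 y := (fine (rnorm2 y)).

Definition toC y : cseq R := fun m => (y m)%:C%C.

Lemma cnorm2_toC y : cnorm2 (toC y) = rnorm2 y.
Proof. by congr l2norm; apply/funext => m; rewrite normcR. Qed.

Lemma cl2_toC y : cl2 (toC y) <-> rl2 y.
Proof. by rewrite /cl2 /rl2/= cnorm2_toC. Qed.

Lemma rl2_sq_le y : rl2 y -> sq_le (fun m => `|y m|) (n2 y).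
Proof.
move=> yl; have := cl2_bd ((cl2_toC y).2 yl); rewrite cnorm2_toC; apply: le_sq_le => m.
by rewrite normcR.
Qed.

Lemma rl2_eq0 y : rl2 y -> n2 y = 0 -> y = 0.
Proof.
move=> rl y0; have yl := (cl2_toC y).2 rl; apply/funext => m.
by have := n2_eq0 m yl; rewrite cnorm2_toC y0 => /(_ erefl) [].
Qed.

(* The entry [y m] is put entirely in the term [n] for which [e^(n/2)] is
   comparable to [|y m| / ||y||]. *)
Let level y m : int := Num.floor (2 * ln (`|y m| / n2 y)).
Let layers y (n : int) : rseq R :=
  fun m => if n == level y m then expR (- (theta * n%:~R)) * y m else 0.

(** With $r = |y(m)|/\|y\|$ and $k \le 2\ln r < k+1$, one has $e^{-k/2} r \le e^{1/2} \le 2$ and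
    $e^{k/2} \le r$. *)
Let layers_bounds y m n : rl2 y ->
  `|layers y n m| <= 2 * n2 y /\ expR n%:~R * `|layers y n m| <= `|y m| ^+ 2 / n2 y.
Proof.
move=> yl; have l0 : 0 <= n2 y := (rl2_sq_le yl).1.
have triv : 0 <= 2 * n2 y /\ 0 <= `|y m| ^+ 2 / n2 y.
  by rewrite mulr_ge0// divr_ge0// sqr_ge0.
rewrite /layers; case: eqP => [->|_]; last by rewrite normr0 mulr0.
have [->|y0] := eqVneq (y m) 0.
  by rewrite mulr0 normr0 mulr0 expr0n/= mul0r mulr_ge0.
have lp : 0 < n2 y.
  rewrite lt_neqAle l0 andbT eq_sym; apply: contra y0 => /eqP/(rl2_eq0 yl) ->//.
have yp : 0 < `|y m| by rewrite normr_gt0.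
have := floor_itv (2 * ln (`|y m| / n2 y)); rewrite -/(level y m).
set r := `|y m| / n2 y; set k := (level y m)%:~R; rewrite rmorphD/= => /andP[kr rk].
have rp : 0 < r by rewrite divr_gt0.
have rE : expR (ln r) = r by rewrite lnK.
have yE : `|y m| = r * n2 y by rewrite /r divfK// gt_eqF.
rewrite normrM (gtr0_norm (expR_gt0 _)); split.
  rewrite yE mulrA ler_wpM2r// -rE -expRD.
  have h : expR (- (theta * k) + ln r) * expR (- theta) <= 1.
    by rewrite -expRD expR_le1 /theta; lra.
  have h2 : 2^-1 <= expR (- theta : R).
    by have := expR_ge1Dx (- theta : R); rewrite /theta; lra.
  by have := expR_ge0 (- (theta * k) + ln r); nra.
rewrite mulrA -expRD expr2 -mulrA mulrC ler_wpM2l// -/r.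
by rewrite -rE ler_expR /theta; lra.
Qed.

(** This half of the identification of the interpolation space with $\ell_2$ turns the
    near-optimality of a selection into a bound by $2C\|y\|$. *)
Lemma interp_norm_le y : rl2 y -> (interp_norm y <= (2 * n2 y)%:E)%E.
Proof.
move=> yl; have [l0 hl] := rl2_sq_le yl.
have s1 N : \sum_(0 <= m < N) `|y m| ^+ 2 / n2 y <= n2 y.
  rewrite -mulr_suml; have [->|lN0] := eqVneq (n2 y) 0; first by rewrite invr0 mulr0.
  by rewrite ler_pdivrMr ?lt_neqAle 1?eq_sym ?lN0// -expr2.
have q0 m : 0 <= `|y m| ^+ 2 / n2 y by rewrite divr_ge0// sqr_ge0.
have es1 := (esum_nat_leP (n2 y) q0).2 s1.
have hoo n : (rnormoo (layers y n) <= (2 * n2 y)%:E)%E.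
  by apply: ge_ereal_sup => _ [m _ <-]; rewrite lee_fin; case: (layers_bounds m n yl).
have h1 n : (rnorm1 (layers y n) < +oo)%E.
  apply: (@le_lt_trans _ _ (expR (- n%:~R) * n2 y)%:E); last exact: ltry.
  apply/esum_nat_leP => // N; apply: le_trans (ler_wpM2l (expR_ge0 _) (s1 N)).
  rewrite mulr_sumr; apply: ler_sum => m _.
  rewrite expRN mulrC ler_pdivlMr ?expR_gt0// mulrC.
  by case: (layers_bounds m n yl).
have hJ : (Jnorm (layers y) <= (2 * n2 y)%:E)%E.
  rewrite /Jnorm ge_max; apply/andP; split.
    by apply: ge_ereal_sup => _ [n _ <-].
  rewrite /J1norm esum_swap//; apply: (@le_trans _ _ (n2 y)%:E); last first.
    by rewrite lee_fin ler_peMl// ler1n.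
  apply: le_trans es1; apply: le_esum => m _.
  (* For fixed [m] only the term at [level y m] survives. *)
  rewrite (eq_esum (b := fun n => if n \in [set level y m] then
     (expR n%:~R * `|layers y n m|)%:E else 0%E)); last first.
    move=> n _; rewrite -[(_ *: _) m]/(expR n%:~R * layers y n m) normrM.
    rewrite (gtr0_norm (expR_gt0 _)) in_set1 /layers.
    by case: eqP => // _; rewrite normr0 mulr0.
  rewrite -esum_mkcond esum_set1 ?lee_fin ?mulr_ge0 ?expR_ge0//.
  by case: (layers_bounds m (level y m) yl).
apply: ge_ereal_inf; exists (Jnorm (layers y)) => //; exists (layers y) => //.
split.
  split; last exact: le_lt_trans hJ (ltry _).
  by move=> n; split=> //; exact: le_lt_trans (hoo n) (ltry _).
apply/funext => m; rewrite /Jsum (zsum_single (k := level y m)).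
  by rewrite /layers eqxx mulrA -expRD addrN expR0 mul1r.
by move=> n nk; rewrite /layers (negPf nk) mulr0.
Qed.

Section Differential.
Variables (C : R) (hC : 1 < C) (sel : rseq R -> int -> rseq R).
Hypothesis hsel : selection C sel.

Lemma Omega_zero : Omega sel 0 = 0.
Proof.
have z : rl2 (0 : rseq R).
  rewrite /rl2/= /rnorm2 /l2norm esum1 ?poweR0r ?ltry// => m _.
  by rewrite normr0 expr0n.
have [_ _ /(_ 0 0 z)] := hsel; rewrite scale0r => s0.
apply/funext => m; rewrite /Omega /Jdiff s0 (zsum_single (k := 0)).
  by rewrite !mul0r.
by move=> n _; rewrite -[(0 *: _) m]/(0 * _) mul0r mulr0.
Qed.

(** The factor $2C+2$ bounds the norm of $w$ relative to $\|y\|$; $2 + 2C\cdot$[decay_mass] comes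
    from [Jdiff_compare], and $4(2C+3) = 4((2C+2)+1)$ from [KP_compare]. *)
Definition Omega_defect_bound : R :=
  2 * ((2 + 2 * C * decay_mass) * (2 * C + 2) + expR (- theta) * (4 * (2 * C + 3))).

(** Both terms are close to the same product $2e^{-\theta}\ln(w/L)\,y$: the [KP] term because $|y|
    \le w$, and [Omega] because $L\,a(m) \le w(m)^2$. *)
Lemma Omega_KP_compare y : rl2 y ->
  cbd (toC (Omega sel y) - (expR (- theta))%:C%C *: KP (toC y))
      (Omega_defect_bound * n2 y).
Proof.
move=> yl; have [l0 hl] := rl2_sq_le yl.
have dm : 0 <= decay_mass :> R by rewrite mulr_ge0 ?exprn_ge0.
have [e|lN0] := eqVneq (n2 y) 0.
  rewrite (rl2_eq0 yl e) Omega_zero (_ : _ - _ = cst 0).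
    rewrite -(rl2_eq0 yl e) e mulr0; split=> // N.
    by rewrite expr0n big1// => m _; rewrite Normc.normc0 expr0n.
  apply/funext => m.
  by rewrite -[LHS]/(0%:C%C - _ * (_ * 0%:C%C)) !mulr0 subr0.
have lp : 0 < n2 y by rewrite lt_neqAle eq_sym lN0.
set L := n2 y in l0 lp hl *.
have [hs1 hs2 _] := hsel.
have C0 : 0 <= C by apply: ltW; exact: lt_trans hC.
have hJ : (Jnorm (sel y) <= (2 * C * L)%:E)%E.
  apply: le_trans (hs2 _ yl) _; rewrite [2 * C]mulrC -mulrA EFinM.
  by apply: lee_wpmul2l (interp_norm_le yl); rewrite lee_fin.
have [bM [a [a0 ha suma]]] := Jnorm_bounds hJ.
(* The summable term [2^-(m+1)] only keeps [w] away from 0. *)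
pose q m := L * a m + `|y m| ^+ 2 + L ^+ 2 * 2^-1 ^+ m.+1.
have q0 m : 0 < q m.
  by rewrite ltr_wpDl ?addr_ge0 ?sqr_ge0 ?mulr_ge0// mulr_gt0 ?exprn_gt0 ?invr_gt0.
pose w m := Num.sqrt (q m).
have wp m : 0 < w m by rewrite sqrtr_gt0.
have w2 m : w m ^+ 2 = q m by rewrite sqr_sqrtr// ltW.
have wW : sq_le w ((2 * C + 2) * L).
  split=> [|N]; first by rewrite mulr_ge0 ?ltW//; lra.
  under eq_bigr do rewrite w2.
  rewrite /q !big_split/= -!mulr_sumr.
  have half : \sum_(0 <= m < N) 2^-1 ^+ m.+1 = 1 - 2^-1 ^+ N :> R.
    elim: N => [|N IH]; first by rewrite big_geq// expr0 subrr.
    by rewrite big_nat_recr//= IH exprS; field.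
  have hN : 0 <= 2^-1 ^+ N :> R by rewrite exprn_ge0.
  have e1 : L * \sum_(0 <= m < N) a m <= L * (2 * C * L) by rewrite ler_wpM2l.
  have e2 : L ^+ 2 * \sum_(0 <= m < N) 2^-1 ^+ m.+1 <= L ^+ 2.
    by rewrite half ler_piMr ?sqr_ge0//; lra.
  have e3 := hl N.
  (* The three parts of [q] sum to at most $2CL^2$, $L^2$ and $L^2$. *)
  apply: (@le_trans _ _ ((2 * C + 2) * L ^+ 2)); first by lra.
  by rewrite exprMn ler_wpM2r ?sqr_ge0//; nra.
have yw m : Normc.normc (toC y m) <= w m.
  rewrite normcR -[leLHS]sqrtr_sqr ler_wsqrtr//.
  rewrite /q real_normK ?num_real// -addrA addrCA lerDl.
  by rewrite addr_ge0// mulr_ge0 ?sqr_ge0 ?exprn_ge0 ?invr_ge0.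
have yL : fine (cnorm2 (toC y)) <= L by rewrite cnorm2_toC.
have h1 := KP_compare ((cl2_toC y).2 yl) yw wW yL.
have h2 m : `|Omega sel y m - expR (- theta) * (2 * ln (w m / L)) * y m| <=
    (2 + 2 * C * decay_mass) * w m.
  (* With $s = w(m)/L$, both error terms are multiples of $w(m)$: $a(m)/s = L\,a(m)/w(m) \le w(m)$
     and $2CL\,s = 2C\,w(m)$. *)
  have sp : 0 < w m / L by rewrite divr_gt0.
  have := Jdiff_compare sp (bM^~ m) (ha m).
  have -> : zsum (fun n => expR (theta * n%:~R) * sel y n m) = y m.
    by rewrite -[in RHS](hs1 _ yl).2.
  rewrite -[zsum _]/(Omega sel y m) => /le_trans; apply.
  have aw : L * a m <= w m * w m.
    rewrite -expr2 w2 /q -addrA lerDl addr_ge0 ?sqr_ge0//.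
    by rewrite mulr_ge0 ?sqr_ge0 ?exprn_ge0.
  have aw' : a m / (w m / L) <= w m.
    by rewrite ler_pdivrMr// mulrCA mulrA ler_pdivlMr// mulrC.
  have -> : 2 * C * L * (w m / L) * decay_mass = 2 * C * decay_mass * w m.
    by field; rewrite gt_eqF.
  by rewrite [leRHS]mulrDl lerD2r -mulrA ler_wpM2l// mulrC.
have c0 : 0 <= 2 + 2 * C * decay_mass by rewrite addr_ge0 ?mulr_ge0//; lra.
have h3 : cbd (fun m => (Omega sel y m - expR (- theta) * (2 * ln (w m / L)) * y m)%:C%C)
    ((2 + 2 * C * decay_mass) * ((2 * C + 2) * L)).
  have := sq_leZ (2 + 2 * C * decay_mass) wW; rewrite (ger0_norm c0).
  apply: le_sq_le => m; rewrite normcR normr_id (le_trans (h2 m))//.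
  exact: ler_norm.
have := cbdD h3 (cbdN (cbdZ (expR (- theta))%:C%C h1)).
rewrite normcR (gtr0_norm (expR_gt0 _)).
set B := (X in cbd _ X -> _); have -> : B = Omega_defect_bound * L.
  by rewrite /B /Omega_defect_bound; ring.
congr cbd; apply/funext => m.
rewrite -[LHS]/(_ - (expR (- theta))%:C%C * (KP (toC y) m - _)) !rmorphB !rmorphM.
rewrite -[RHS]/((Omega sel y m)%:C%C - (expR (- theta))%:C%C * KP (toC y) m).
by rewrite /toC; ring.
Qed.

End Differential.

End RealKaltonPeckMap.

Lemma qcontinuous_bounded (R : realType) (K : pzRingType) (V W : lmodType K)
    (E : qspace R V) (F : qspace R W) (T : V -> W) (A : R) :
  0 < A -> Defs.subspace (qdom E) -> linear_on (qdom E) T ->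
  (forall u, qdom E u -> qnorm F (T u) <= A * qnorm E u) -> qcontinuous E F T.
Proof.
move=> A0 [_ sE] lT hT u Eu e e0; exists (e / A); first exact: divr_gt0.
move=> v Ev uv; have vu : v - u = -1 *: u + v by rewrite scaleN1r addrC.
have -> : T v - T u = T (v - u) by rewrite vu lT// scaleN1r addrC.
apply: le_lt_trans (hT _ _) _; first by rewrite vu; exact: sE.
by rewrite mulrC -ltr_pdivlMr.
Qed.

(** * The isomorphism by real and imaginary parts *)

Section Isomorphism.
Context {R : realType}.
Variables (C : R) (hC : 1 < C) (sel : rseq R -> int -> rseq R).
Hypothesis hsel : selection C sel.

Local Notation B := (Omega_defect_bound C).
Local Notation kappa := (expR (- theta) : R).
Local Notation pairs := (rseq R * rseq R)%type.
Implicit Types (p : pairs) (w : cseq R * cseq R) (z : complexified pairs) (c : R).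

(** The factor $\kappa^{-1}$ compensates for [Omega] being close to $\kappa\,\mathsf{KP}$. *)
Definition to_Z2 p : cseq R * cseq R := (kappa^-1%:C%C *: toC p.1, toC p.2).

Definition split_map w : complexified pairs :=
  ((fun m => kappa * complex.Re (w.1 m), fun m => complex.Re (w.2 m)),
   (fun m => kappa * complex.Im (w.1 m), fun m => complex.Im (w.2 m))).

Definition join_map z : cseq R * cseq R := to_Z2 z.1 + 'i%C *: to_Z2 z.2.

Let kappa0 : 0 < kappa. Proof. exact: expR_gt0. Qed.

Let kappaK : kappa * kappa^-1 = 1. Proof. by rewrite divff// gt_eqF. Qed.

Let B0 : 0 <= B.
Proof.
have C0 : 0 <= C by apply: ltW; exact: lt_trans hC.
by rewrite /Omega_defect_bound /decay_mass !(addr_ge0, mulr_ge0, exprn_ge0)// expR_ge0.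
Qed.

Lemma toCB (x y : rseq R) : toC (x - y) = toC x - toC y.
Proof. by apply/funext => m; rewrite /toC rmorphB. Qed.

Lemma kappa_scale (x y : cseq R) :
  kappa%:C%C *: (kappa^-1%:C%C *: x - y) = x - kappa%:C%C *: y.
Proof. by rewrite scalerBr scalerA -rmorphM kappaK scale1r. Qed.

(** Write $\kappa^{-1}x - \mathsf{KP}(y)$ as $\kappa^{-1}$ times the sum of $x - \Omega(y)$ and
    $\Omega(y) - \kappa\,\mathsf{KP}(y)$. *)
Lemma Z2bd_to_Z2 p : qdom (Z2real sel) p ->
  Z2bd (to_Z2 p) ((1 + kappa^-1 * (2 * (1 + B))) * qnorm (Z2real sel) p).
Proof.
move=> [l2 l1]; set c := qnorm _ p.
have h1 := cl2_bd ((cl2_toC _).2 l1); rewrite toCB in h1.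
have h2 := cl2_bd ((cl2_toC _).2 l2); rewrite cnorm2_toC in h2.
have h3 := Omega_KP_compare hC hsel l2.
have c1 : fine (cnorm2 (toC (p.1 - Omega sel p.2))) <= c.
  by rewrite cnorm2_toC lerDl h2.1.
have c2 : fine (rnorm2 p.2) <= c by rewrite lerDr -cnorm2_toC n2_ge0.
have c0 : 0 <= c := le_trans h2.1 c2.
have k0 : 0 <= kappa^-1 * (2 * (1 + B)).
  by rewrite mulr_ge0 ?invr_ge0 ?expR_ge0// mulr_ge0// addr_ge0.
split; first by apply: sq_le_widen h2 _; rewrite (le_trans c2)// ler_peMl// lerDl.
have := cbdZ kappa^-1%:C%C (cbdD h1 h3); rewrite toCB in c1 *.
rewrite addrA subrK -kappa_scale scalerA -rmorphM [_ * kappa]mulrC kappaK scale1r.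
move=> /sq_le_widen; apply.
rewrite normcR ger0_norm ?invr_ge0 ?expR_ge0// [leRHS]mulrDl mul1r.
apply: ler_wpDl => //; rewrite -mulrA -[2 * _ * c]mulrA !ler_wpM2l ?invr_ge0 ?expR_ge0//.
have -> : (1 + B) * c = c + B * c by ring.
by rewrite lerD// ler_wpM2l//.
Qed.

(** The same decomposition, solved for $x - \Omega(y)$. *)
Lemma to_Z2_Z2bd p c : Z2bd (to_Z2 p) c ->
  qdom (Z2real sel) p /\ qnorm (Z2real sel) p <= (1 + 2 * (kappa + B)) * c.
Proof.
move=> [h2 h1]; have [l2 e2] := cnorm2_fineP h2.
have rl := (cl2_toC _).1 l2; rewrite cnorm2_toC in e2.
have := cbdD (cbdZ kappa%:C%C h1) (cbdN (Omega_KP_compare hC hsel rl)).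
rewrite kappa_scale opprB addrA subrK -toCB.
move=> /cnorm2_fineP[/cl2_toC l1]; rewrite cnorm2_toC => e1; split=> //.
rewrite /= mulrDl mul1r addrC lerD// (le_trans e1)//.
rewrite -mulrA ler_wpM2l// mulrDl normcR gtr0_norm// lerD2l.
by rewrite ler_wpM2l.
Qed.

Lemma split_map_linear (a : R[i]) w w' :
  split_map (a *: w + w') = a *: split_map w + split_map w'.
Proof.
have reE (b x y : R[i]) : complex.Re (b * x + y) =
    complex.Re b * complex.Re x - complex.Im b * complex.Im x + complex.Re y.
  by case: b x y => [? ?] [? ?] [? ?].
have imE (b x y : R[i]) : complex.Im (b * x + y) =
    complex.Re b * complex.Im x + complex.Im b * complex.Re x + complex.Im y.
  by case: b x y => [? ?] [? ?] [? ?].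
congr pair; congr pair; apply/funext => m.
- rewrite -[LHS]/(kappa * complex.Re (a * w.1 m + w'.1 m)) reE.
  rewrite -[RHS]/(complex.Re a * (kappa * complex.Re (w.1 m)) -
    complex.Im a * (kappa * complex.Im (w.1 m)) + kappa * complex.Re (w'.1 m)).
  by ring.
- exact: reE.
- rewrite -[LHS]/(kappa * complex.Im (a * w.1 m + w'.1 m)) imE.
  rewrite -[RHS]/(complex.Re a * (kappa * complex.Im (w.1 m)) +
    complex.Im a * (kappa * complex.Re (w.1 m)) + kappa * complex.Im (w'.1 m)).
  by ring.
- exact: imE.
Qed.

Lemma split_mapK : cancel split_map join_map.
Proof.
move=> w; rewrite [RHS]surjective_pairing; congr pair; apply/funext => m.
  rewrite -[LHS]/((kappa^-1)%:C%C * (kappa * complex.Re (w.1 m))%:C%C +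
    'i%C * ((kappa^-1)%:C%C * (kappa * complex.Im (w.1 m))%:C%C)).
  by rewrite -!rmorphM !mulrA [_^-1 * _]mulrC kappaK !mul1r -complexE.
rewrite -[LHS]/((complex.Re (w.2 m))%:C%C + 'i%C * (complex.Im (w.2 m))%:C%C).
by rewrite -complexE.
Qed.

Lemma join_mapK : cancel join_map split_map.
Proof.
move=> [[p1 p2] [q1 q2]].
have reE (x y : R) : complex.Re (x%:C%C + 'i%C * y%:C%C) = x.
  by rewrite /= mul0r mul1r subrr addr0.
have imE (x y : R) : complex.Im (x%:C%C + 'i%C * y%:C%C) = y.
  by rewrite /= mul0r mul1r !add0r.
congr pair; congr pair; apply/funext => m; rewrite ?[LHS]reE ?[LHS]imE//.
- rewrite -[LHS]/(kappa * complex.Re (_%:C%C * (p1 m)%:C%C + 'i%C * (_%:C%C * (q1 m)%:C%C))).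
  by rewrite -!rmorphM reE mulrA kappaK mul1r.
- rewrite -[LHS]/(kappa * complex.Im (_%:C%C * (p1 m)%:C%C + 'i%C * (_%:C%C * (q1 m)%:C%C))).
  by rewrite -!rmorphM imE mulrA kappaK mul1r.
Qed.

(** The real part is half of $w + \bar w$, and conjugation preserves [Z2bd]; the half cancels the
    doubling of [c]. *)
Lemma split_map1_bd w c : Z2bd w c ->
  Z2bd (to_Z2 (split_map w).1) (Z2_quasi * c).
Proof.
move=> h.
have -> : to_Z2 (split_map w).1 = 2^-1%:C%C *: (w + (cconj w.1, cconj w.2)).
  have J (x : R[i]) : 2^-1%:C%C * (x + x^*%C) = (complex.Re x)%:C%C.
    by rewrite ReJ_add mulrC fmorphV rmorph_nat.
  congr pair; apply/funext => m; last by rewrite -[RHS]/(_ * (w.2 m + (w.2 m)^*%C)) J.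
  rewrite -[RHS]/(_ * (w.1 m + (w.1 m)^*%C)) J.
  rewrite -[LHS]/(_%:C%C * (kappa * _)%:C%C) -rmorphM mulrA [_^-1 * _]mulrC kappaK.
  by rewrite mul1r.
have := Z2bdZ 2^-1%:C%C (Z2bdD h (Z2bdJ h)).
by rewrite normcR ger0_norm// (_ : 2^-1 * _ = Z2_quasi * c)//; field.
Qed.

(** Since $\mathrm{Im}\,x = \mathrm{Re}(-ix)$ and $|-i| = 1$, imaginary parts inherit the bound for
    real parts. *)
Lemma split_map2E w : (split_map w).2 = (split_map (- 'i%C *: w)).1.
Proof.
have E (x : R[i]) : complex.Im x = complex.Re (- 'i%C * x).
  by case: x => a b /=; rewrite oppr0 mul0r mulN1r sub0r opprK.
by congr pair; apply/funext => m /=; rewrite E.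
Qed.

Lemma split_map2_bd w c : Z2bd w c -> Z2bd (to_Z2 (split_map w).2) (Z2_quasi * c).
Proof.
move=> h; rewrite split_map2E.
have := Z2bdZ (- 'i%C) h.
rewrite (normcN 'i%C) /= expr0n expr1n/= add0r sqrtr1 mul1r.
exact: split_map1_bd.
Qed.

Lemma Z2_subspace : Defs.subspace (qdom (@Z2 R)).
Proof.
split=> [|a u v /Z2_bd hu /Z2_bd hv].
  apply: (Z2bdP (c := 0) _).1; split.
    by split=> // N; rewrite expr0n big1// => m _; rewrite Normc.normc0 expr0n.
  split=> // N; rewrite expr0n big1// => m _.
  rewrite (_ : (_ - _) m = 0) ?Normc.normc0 ?expr0n//.
  by rewrite -[LHS]/(0 - _ * 0) mulr0 subr0.
exact: (Z2bdP (Z2bdD (Z2bdZ a hu) hv)).1.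
Qed.

Let F := complexification (Z2real sel).

Lemma join_map_bd : exists2 A, 0 < A & forall z, qdom F z ->
  Z2bd (join_map z) (A * qnorm F z).
Proof.
set K := 1 + kappa^-1 * (2 * (1 + B)).
have K0 : 0 < K.
  by rewrite ltr_pwDl// mulr_ge0 ?invr_ge0 ?expR_ge0// mulr_ge0// addr_ge0.
exists (Z2_quasi * (K + K)); first exact: mulr_gt0 Z2_quasi_gt0 (addr_gt0 K0 K0).
move=> z [/Z2bd_to_Z2 h1 /Z2bd_to_Z2 h2].
have [] := Z2bdD h1 (Z2bdZ 'i%C h2).
rewrite /= expr0n expr1n/= add0r sqrtr1 mul1r -/K => e1 e2.
set q1 := qnorm (Z2real sel) z.1 in e1 e2; set q2 := qnorm (Z2real sel) z.2 in e1 e2.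
have le : Z2_quasi * (K * q1 + K * q2) <= Z2_quasi * (K + K) * qnorm F z.
  rewrite -mulrA [(K + K) * _]mulrDl (ler_wpM2l (ltW Z2_quasi_gt0))//.
  by apply: lerD; apply: ler_wpM2l (ltW K0) _ _ _; rewrite le_max lexx ?orbT.
by split; [exact: sq_le_widen e1 le|exact: sq_le_widen e2 le].
Qed.

Lemma split_map_bd : exists2 A, 0 < A & forall w, qdom Z2 w ->
  qdom F (split_map w) /\ qnorm F (split_map w) <= A * qnorm Z2 w.
Proof.
set K := 1 + 2 * (kappa + B).
have K0 : 0 < K by rewrite ltr_pwDl// mulr_ge0// addr_ge0// ltW.
exists (K * Z2_quasi); first exact: mulr_gt0 K0 Z2_quasi_gt0.
move=> w /Z2_bd h.
have [d1 n1] := to_Z2_Z2bd (split_map1_bd h).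
have [d2 n2] := to_Z2_Z2bd (split_map2_bd h).
by split=> //; rewrite ge_max -mulrA n1 n2.
Qed.

Lemma join_map_linear (a : R[i]) z z' :
  join_map (a *: z + z') = a *: join_map z + join_map z'.
Proof.
by apply: (can_inj split_mapK); rewrite join_mapK split_map_linear !join_mapK.
Qed.

(** The subspace property is transported from [Z2] through the two inverse maps, which avoids a
    separate quasi-additivity argument for [Omega]. *)
Lemma complexification_Z2real_subspace : Defs.subspace (qdom F).
Proof.
have [A _ hj] := join_map_bd; have [A' _ hs] := split_map_bd.
have [z0 zD] := Z2_subspace.
have dj z : qdom F z -> qdom Z2 (join_map z) by move=> /hj/Z2bdP[].
split=> [|a z z' /dj hz /dj hz'].
  have := (hs _ z0).1; congr (qdom F).
  (* Linearity with scalar $-1$ at 0 gives [split_map 0 = 0]. *)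
  by have := split_map_linear (- 1) 0 0; rewrite scaler0 add0r scaleN1r addNr.
have := (hs _ (zD a _ _ hz hz')).1.
by rewrite -join_map_linear join_mapK.
Qed.

Lemma Z2_isomorphic : isomorphic (@Z2 R) F.
Proof.
have [A A0 hj] := join_map_bd; have [A' A'0 hs] := split_map_bd.
have dj z : qdom F z -> qdom Z2 (join_map z) by move=> /hj/Z2bdP[].
split; [exact: Z2_subspace|exact: complexification_Z2real_subspace|].
exists split_map, join_map; split.
- by move=> a u v _ _; exact: split_map_linear.
- by move=> u /hs[]; rewrite split_mapK.
- by move=> z /dj; rewrite join_mapK.
- apply: (qcontinuous_bounded A'0 Z2_subspace) => [a u v _ _|u /hs[]//].
  exact: split_map_linear.
(* The 2 is the loss in [Z2bdP], where the quasi-norm adds two parts each bounded by [c]. *)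
- apply: (@qcontinuous_bounded _ _ _ _ _ _ _ (2 * A)).
  + by rewrite mulr_gt0.
  + exact: complexification_Z2real_subspace.
  + by move=> a u v _ _; exact: join_map_linear.
  + by move=> z /hj/Z2bdP[_]; rewrite mulrA.
Qed.

End Isomorphism.

Theorem theorem1 (R : realType) (C : R) (hC : 1 < C)
    (sel : rseq R -> int -> rseq R) (hsel : selection C sel) :
  isomorphic (@Z2 R) (complexification (Z2real sel)).
Proof. exact: (@Z2_isomorphic R C hC sel hsel). Qed.
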